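(* Assume $t_0>0$, $\alpha>3$, and that $\xi:[t_0,+\infty)\to(0,+\infty)$ is a differentiable function for which there exist $t_1\ge t_0$ and a (sufficiently small) constant $\delta>0$ such that $$\Big(2-\frac{2\alpha}{3}\Big)+t\,\frac{\dot\xi(t)}{\xi(t)}<-\delta\qquad\text{for all } t\ge t_1 .$$ Let $(x(t),\lambda(t))_{t\ge t_0}$ be any solution of the dynamical system (PDDS-IHD) described in the context, and let $(x^*,\lambda^* )\in\Omega$ be any primal-dual optimal solution. Then $(x(\cdot),\lambda(\cdot))$ is bounded, and, with $\beta(t)=\gamma+\frac{\beta}{t}$, the following hold. Integral estimates: $$\int_{t_0}^{+\infty} t\,\xi(t)\big(\mathcal{L}_\rho(x(t)+\beta(t)\dot x(t),\lambda^* )-\mathcal{L}_\rho(x^*,\lambda^* )\big)\,dt<+\infty,$$ $$\int_{t_0}^{+\infty} t\big(\|\dot x(t)\|^2+\|\dot\lambda(t)\|^2\big)\,dt<+\infty,\qquad \int_{t_0}^{+\infty} t\,\xi(t)\,\|A(x(t)+\beta(t)\dot x(t))-b\|^2\,dt<+\infty .$$ Pointwise estimates, as $t\to+\infty$: $$\mathcal{L}_\rho(x(t)+\beta(t)\dot x(t),\lambda^* )-\mathcal{L}_\rho(x^*,\lambda^* )=\mathcal{O}\Big(\frac{1}{t^2\xi(t)}\Big),\qquad \|(\dot x(t),\dot\lambda(t))\|=\mathcal{O}\Big(\frac1t\Big),$$ $$\|A(x(t)+\beta(t)\dot x(t))-b\|=\mathcal{O}\Big(\frac{1}{t^2\xi(t)}\Big),\qquad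 |f(x(t)+\beta(t)\dot x(t))-f(x^* )|=\mathcal{O}\Big(\frac{1}{t^2\xi(t)}\Big).$$
   Context: $\mathcal{X},\mathcal{Y}$ are real Hilbert spaces, $f:\mathcal{X}\to\mathbb{R}$ is convex and continuously differentiable, $A:\mathcal{X}\to\mathcal{Y}$ is a continuous linear operator with adjoint $A^T$, $b\in\mathcal{Y}$. The problem is $\min_{x\in\mathcal{X}} f(x)$ subject to $Ax=b$. The Lagrangian is $\mathcal{L}(x,\lambda)=f(x)+\langle\lambda,Ax-b\rangle$ and the augmented Lagrangian is $\mathcal{L}_\rho(x,\lambda)=\mathcal{L}(x,\lambda)+\frac{\rho}{2}\|Ax-b\|^2$ with a fixed $\rho>0$; thus $\nabla_x\mathcal{L}_\rho(x,\lambda)=\nabla f(x)+A^T\lambda+\rho A^T(Ax-b)$ and $\nabla_\lambda\mathcal{L}_\rho(x,\lambda)=Ax-b$. $\Omega$ is the set of saddle points of $\mathcal{L}$, i.e. the pairs $(x^*,\lambda^* )\in\mathcal{X}\times\mathcal{Y}$ with $\mathcal{L}(x^*,\lambda)\le\mathcal{L}(x^*,\lambda^* )\le\mathcal{L}(x,\lambda^* )$ for all $(x,\lambda)$; elements of $\Omega$ are called primal-dual optimal solutions. It is assumed that $\Omega\ne\emptyset$. On $\mathcal{X}\times\mathcal{Y}$ the product norm is used. Dynamical system (PDDS-IHD), for $t\ge t_0>0$ and $\alpha>0$: $$\ddot x(t)+\frac{\alpha}{t}\dot x(t)+\xi(t)\nabla_x\mathcal{L}_\rho(\hat x(t),\bar\lambda(t))=0,$$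 $$\ddot\lambda(t)+\frac{\alpha}{t}\dot\lambda(t)-\xi(t)\Big(\nabla_\lambda\mathcal{L}_\rho(\bar x(t),\lambda(t))+\eta(t)A\dot x(t)-\frac{3}{2\alpha}t\,\xi(t)\beta(t)\,A\nabla_x\mathcal{L}_\rho(\hat x(t),\bar\lambda(t))\Big)=0,$$ where $\beta(t)=\gamma+\frac{\beta}{t}$ with constants satisfying either $\gamma>0,\ \beta\in\mathbb{R}$, or $\gamma=0,\ \beta\ge0$; $\hat x(t)=x(t)+\beta(t)\dot x(t)$; $\bar x(t)=x(t)+\frac{3}{2\alpha}t\dot x(t)$; $\bar\lambda(t)=\lambda(t)+\frac{3}{2\alpha}t\dot\lambda(t)$; $\eta(t)=\frac{1}{2\alpha}(-\alpha\beta(t)+3t\dot\beta(t))$; and $\xi:[t_0,+\infty)\to(0,+\infty)$ is continuous. A solution is a pair of twice differentiable functions $x:[t_0,+\infty)\to\mathcal{X}$, $\lambda:[t_0,+\infty)\to\mathcal{Y}$ satisfying both equations for all $t\ge t_0$. *)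

(* Defs.v *)
From HB Require Import structures.
From mathcomp Require Import all_boot all_order all_algebra sesquilinear.
From mathcomp Require Import all_classical all_reals all_analysis.

Set Implicit Arguments.
Unset Strict Implicit.
Unset Printing Implicit Defensive.

Import Order.TTheory GRing.Theory Num.Theory.
Import numFieldNormedType.Exports.

Local Open Scope classical_set_scope.
Local Open Scope ring_scope.

(* A real Hilbert space: a complete normed space whose norm is induced by an
   inner product (positive definite symmetric bilinear form). *)
HB.mixin Record CompleteNormedModule_isHilbert (R : realType) X
    of CompleteNormedModule R X := {
  inner : {dot X for (@idfun R)} ;
  normE_inner : forall x : X, `|x| ^+ 2 = inner x x
}.

#[short(type="hilbertType")]
HB.structure Definition Hilbert (R : realType) :=
  {X of CompleteNormedModule_isHilbert R X & CompleteNormedModule R X}.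

Notation "''<|' x , y |>" := (inner x y)
  (at level 2, x at level 99, y at level 99, format "''<|' x ,  y |>")
  : ring_scope.

(* Lets the Landau notations be used at the filter +oo of the reals. *)
Canonical pinfty_filter_on (R : numFieldType) :=
  FilterType (pinfty_nbhs R) (filter_filter (F := pinfty_nbhs R)).

Section DerivativeOnASet.
Context {R : realType} {V : normedModType R}.

(* Derivative at t of a function of which only the restriction to D matters:
   the increments s stay in D, so that at the left endpoint of an interval the
   derivative is the right derivative. *)
Definition diff_quotient (f : R -> V) (t s : R) : V :=
  (s - t)^-1 *: (f s - f t).

Definition derivable_in (D : set R) (f : R -> V) (t : R) : Prop :=
  cvg (diff_quotient f t @ within D t^').

Definition derive_in (D : set R) (f : R -> V) (t : R) : V :=
  lim (diff_quotient f t @ within D t^').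

Definition twice_derivable_in (D : set R) (f : R -> V) : Prop :=
  forall t, D t -> derivable_in D f t /\ derivable_in D (derive_in D f) t.

End DerivativeOnASet.

Section HilbertCalculus.
Context {R : realType} {X Y : hilbertType R}.

Definition is_gradient (f : X -> R) (gradf : X -> X) : Prop :=
  forall x, differentiable f x /\ forall h, 'd f x h = '<| gradf x, h |>.

Definition is_adjoint (A : X -> Y) (AT : Y -> X) : Prop :=
  forall x y, '<| A x, y |> = '<| x, AT y |>.

(* The Hilbert norm of the product; the library's norm on X * Y is the max. *)
Definition prod_norm (x : X) (y : Y) : R := Num.sqrt (`|x| ^+ 2 + `|y| ^+ 2).

End HilbertCalculus.

Section Lagrangian.
Context {R : realType} {X Y : hilbertType R}.
Variables (f : X -> R) (gradf : X -> X).
Variables (A : X -> Y) (AT : Y -> X) (b : Y) (rho : R).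

Definition Lagr (x : X) (l : Y) : R := f x + '<| l, A x - b |>.

Definition augLagr (x : X) (l : Y) : R :=
  Lagr x l + rho / 2 * `|A x - b| ^+ 2.

Definition grad_x_augLagr (x : X) (l : Y) : X :=
  gradf x + AT l + rho *: AT (A x - b).

Definition grad_l_augLagr (x : X) (l : Y) : Y := A x - b.

Definition saddle_points : set (X * Y) :=
  [set p | forall x l, Lagr p.1 l <= Lagr p.1 p.2 /\ Lagr p.1 p.2 <= Lagr x p.2].

End Lagrangian.

Section DynamicalSystem.
Context {R : realType} {X Y : hilbertType R}.

(* beta(t) = gamma + beta / t *)
Definition damp (gamma beta t : R) : R := gamma + beta / t.

Definition eta_coef (alpha gamma beta t : R) : R :=
  (2 * alpha)^-1 *
  (- alpha * damp gamma beta t + 3 * t * derive1 (damp gamma beta) t).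

Definition is_PDDS_IHD_solution
    (gradf : X -> X) (A : X -> Y) (AT : Y -> X) (b : Y)
    (rho t0 alpha gamma beta : R) (xi : R -> R)
    (x : R -> X) (lambda : R -> Y) : Prop :=
  let D := `[t0, +oo[%classic in
  let x' := derive_in D x in
  let x'' := derive_in D x' in
  let lambda' := derive_in D lambda in
  let lambda'' := derive_in D lambda' in
  let betaf := damp gamma beta in
  let eta := eta_coef alpha gamma beta in
  let kappa := 3 / (2 * alpha) in
  let xhat t := x t + betaf t *: x' t in
  let xbar t := x t + (kappa * t) *: x' t in
  let lbar t := lambda t + (kappa * t) *: lambda' t in
  let gradx := grad_x_augLagr gradf A AT b rho in
  let gradl := grad_l_augLagr A b in
  [/\ twice_derivable_in D x,
      twice_derivable_in D lambda &
      forall t, t0 <= t ->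
        x'' t + (alpha / t) *: x' t + xi t *: gradx (xhat t) (lbar t) = 0 /\
        lambda'' t + (alpha / t) *: lambda' t
        - xi t *: (gradl (xbar t) (lambda t) + eta t *: A (x' t)
                   - (kappa * t * xi t * betaf t) *:
                       A (gradx (xhat t) (lbar t))) = 0].

End DynamicalSystem.

(* Main.v *)
(* Put kappa = 3 / (2 alpha) < 1/2 and u = A xhat - b. The coefficients of the
   system are such that the second equation reads
     lambda'' + (alpha / t) lambda' = xi (u + kappa t u'),
   and with v = x - xs + kappa t x', w = lambda - ls + kappa t lambda' the energy
     |v|^2/2 + |w|^2/2 + (1/2 - kappa) (|x - xs|^2/2 + |lambda - ls|^2/2)
       + kappa^2 t^2 xi(t) (L_rho(xhat, ls) - L_rho(xs, ls))
   eventually dissipates a multiple of each of the three integrands: the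
   coupling <w, u + kappa t u'> cancels, convexity controls the gap, and the
   cross term eta <x', G> is absorbed by -beta |G|^2 and -t |x'|^2. This gives
   boundedness, the integral estimates and the rates of the gap and the
   velocities. For the residual, w + (1/2 - kappa) (lambda - ls) is bounded and
   has derivative kappa t xi (u + kappa t u'), which is a multiple of the
   derivative of t^(1/kappa) u; since t^(2 - 1/kappa) xi is nonincreasing, an
   integration by parts (in the form of the mean value inequality) bounds
   t^2 xi u. *)
Require Import Defs.
From mathcomp Require Import all_boot all_order all_algebra.
From mathcomp Require Import all_classical all_reals all_analysis.
From mathcomp Require Import measurable_realfun ring lra.
Import Order.TTheory GRing.Theory Num.Theory.
Import numFieldNormedType.Exports.
Local Open Scope classical_set_scope.
Local Open Scope ring_scope.

(** * Inner products: bilinearity, Cauchy-Schwarz, limits *)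

Section InnerProduct.
Context {R : realType} {X : hilbertType R}.
Implicit Types (u v w : X) (k : R).

Lemma innerC u v : '<| u, v |> = '<| v, u |>.
Proof. by have := hermitian_subproof (s := @inner R X) u v; rewrite expr0 mul1r. Qed.

Lemma innerDr u v w : '<| u, v + w |> = '<| u, v |> + '<| u, w |>.
Proof. exact: raddfD. Qed.

Lemma innerZr k u v : '<| u, k *: v |> = k * '<| u, v |>.
Proof. exact: linearZ. Qed.

Lemma innerNr u v : '<| u, - v |> = - '<| u, v |>.
Proof. exact: raddfN. Qed.

Lemma innerDl u v w : '<| v + w, u |> = '<| v, u |> + '<| w, u |>.
Proof. by rewrite innerC innerDr !(innerC u). Qed.

Lemma innerZl k u v : '<| k *: v, u |> = k * '<| v, u |>.
Proof. by rewrite innerC innerZr innerC. Qed.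

Lemma innerNl u v : '<| - v, u |> = - '<| v, u |>.
Proof. by rewrite innerC innerNr innerC. Qed.

Lemma inner0r u : '<| u, 0 |> = 0.
Proof. exact: raddf0. Qed.

Lemma inner0l u : '<| 0, u |> = 0.
Proof. by rewrite innerC inner0r. Qed.

Definition innerE := (innerDl, innerDr, innerNl, innerNr, innerZl, innerZr).

(** The squared norm of [|v|^2 u - <u, v> v] is nonnegative and factors as
    [|v|^2 (|u|^2 |v|^2 - <u, v>^2)]. *)
Lemma CauchySchwarz u v : `|'<| u, v |>| <= `|u| * `|v|.
Proof.
have [->|v0] := eqVneq v 0.
  by rewrite inner0r !normr0 mulr0.
have vv : 0 < `|v| by rewrite normr_gt0.
have uu : 0 <= `|u| by [].
have : 0 <= `|(`|v| ^+ 2) *: u - '<| u, v |> *: v| ^+ 2 by exact: sqr_ge0.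
rewrite normE_inner !innerE -!normE_inner (innerC v u).
set n := `|v| in vv *; set m := `|u| in uu *; set c := '<| u, v |> => H.
have {}H : 0 <= n ^+ 2 * (n ^+ 2 * m ^+ 2 - c ^+ 2) by lra.
rewrite pmulr_rge0 ?exprn_gt0// in H.
rewrite -ler_sqr ?nnegrE ?mulr_ge0 ?(ltW vv)// real_normK ?num_real// exprMn. lra.
Qed.

(** Reduces vector identities to scalar ones: after pairing with an arbitrary vector and expanding
    by [innerE], they become goals for [ring], [field] or [lra]. *)
Lemma inner_ext u v : (forall y, '<| u, y |> = '<| v, y |>) -> u = v.
Proof.
move=> uv; apply/eqP; rewrite -subr_eq0 -normr_eq0 -sqrf_eq0 normE_inner.
by rewrite innerDl innerNl uv subrr.
Qed.

End InnerProduct.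

Lemma prod_norm_le {R : realType} {X Y : hilbertType R} (u : X) (v : Y) :
  `|prod_norm u v| <= `|u| + `|v|.
Proof.
  rewrite ger0_norm ?sqrtr_ge0// -[leRHS]ger0_norm ?addr_ge0// -sqrtr_sqr ler_wsqrtr//.
  by rewrite sqrrD -addrA lerD2l ler_wpDl// mulrn_wge0// mulr_ge0.
Qed.

Section HilbertLimits.
Context {R : realType} {X : hilbertType R}.

Lemma cvg_inner {T : Type} {F : set_system T} {FF : Filter F}
    (g h : T -> X) (a b : X) :
  g @ F --> a -> h @ F --> b -> (fun t => '<| g t, h t |>) @ F --> '<| a, b |>.
Proof.
move=> ga hb; apply/subr_cvg0/norm_cvg0P.
(* The difference splits as [<g - a, h> + <a, h - b>], and Cauchy-Schwarz bounds each half by a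
   product with a factor tending to 0. *)
have E t : `|'<| g t, h t |> - '<| a, b |>| <= `|g t - a| * `|h t| + `|a| * `|h t - b|.
  rewrite (_ : _ - _ = '<| g t - a, h t |> + '<| a, h t - b |>); last first.
    by rewrite !innerE; lra.
  by rewrite (le_trans (ler_normD _ _))// lerD// CauchySchwarz.
apply: (@squeeze_cvgr _ _ _ _ (fun _ => 0)
   (fun t => `|g t - a| * `|h t| + `|a| * `|h t - b|)).
- by apply: nearW => t; rewrite normr_ge0 E.
- exact: cvg_cst.
rewrite [X in _ --> X](_ : _ = 0 * `|b| + `|a| * 0); last by rewrite mul0r mulr0 addr0.
apply: cvgD; apply: cvgM => //.
- by apply/norm_cvg0P/subr_cvg0.
- exact: cvg_norm.
- exact: cvg_cst.
- by apply/norm_cvg0P/subr_cvg0.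
Qed.

End HilbertLimits.

(** * Derivatives through difference quotients: product and chain rules *)

Section DifferenceQuotient.
Context {R : realType} {V : normedModType R}.
Implicit Types (g : R -> V) (t : R).

(** The substitution [s = h + t] passes between increments near 0 and points near [t]. It lets the
    product rules below be proved as limits of algebraic identities between quotients. *)
Lemma is_derive_diff_quotient g t dg :
  diff_quotient g t @ t^' --> dg <-> is_derive t 1 g dg.
Proof.
split => [H|].
  suff H' : h^-1 *: ((g \o shift t) (h *: (1:R)) - g t) @[h --> 0^'] --> dg.
    apply: DeriveDef; first by apply/cvg_ex; exists dg.
    exact/cvg_lim.
  have -> : (fun h => h^-1 *: ((g \o shift t) (h *: (1:R)) - g t)) =
            diff_quotient g t \o (fun h => h + t).
    by apply/funext => h; rewrite /diff_quotient /= addrK [h *: _]mulr1.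
  apply: cvg_comp H => A /= /nbhs_ballP[e e0 He].
  exists e => //= h hb h0; apply: He.
    by rewrite /ball/= in hb *; rewrite opprD addrCA subrr addr0 -[- h]sub0r.
  by apply: contra_neq h0 => /(congr1 (fun x => x - t)); rewrite addrK subrr.
case=> /= dv <-.
have -> : diff_quotient g t =
    (fun h => h^-1 *: ((g \o shift t) (h *: (1:R)) - g t)) \o (fun s => s - t).
  by apply/funext => h; rewrite /diff_quotient /= [_ *: 1]mulr1 subrK.
apply: cvg_comp dv => A /= /nbhs_ballP[e e0 He].
exists e => //= h hb h0; apply: He.
  by rewrite /ball/= in hb *; rewrite sub0r opprB.
by rewrite subr_eq0.
Qed.

Lemma is_derive_continuous g t dg : is_derive t 1 g dg -> {for t, continuous g}.
Proof. by case=> /derivable1_diffP /differentiable_continuous. Qed.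

End DifferenceQuotient.

Lemma is_derive_scale {R : realType} {V : normedModType R}
    (k : R -> R) (g : R -> V) (dk : R) (dg : V) (t : R) :
  is_derive t 1 k dk -> is_derive t 1 g dg ->
  is_derive t 1 (fun s => k s *: g s) (dk *: g t + k t *: dg).
Proof.
move=> dk1 dg1; apply/is_derive_diff_quotient.
(* Adding and subtracting [k t *: g s] leaves one quotient in each summand; the factor [g s] then
   converges by continuity. *)
have -> : diff_quotient (fun s => k s *: g s) t =
    fun s => diff_quotient k t s *: g s + k t *: diff_quotient g t s.
  apply/funext => s; rewrite /diff_quotient !scalerBr !scalerA scalerBl -!addrA.
  congr (_ + _); rewrite [_ * k t]mulrC.
  by rewrite [X in _ = X + _](_ : _ = - ((k t * (s-t)^-1) *: g s)) ?addKr// mulrC.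
apply: cvgD; apply: cvgZ.
- exact/is_derive_diff_quotient.
- by apply: cvg_within_filter; exact: is_derive_continuous dg1.
- exact: cvg_cst.
- exact/is_derive_diff_quotient.
Qed.

Section HilbertDerivatives.
Context {R : realType} {X Y : hilbertType R}.

Lemma is_derive_inner (g h : R -> X) (dg dh : X) (t : R) :
  is_derive t 1 g dg -> is_derive t 1 h dh ->
  is_derive t 1 (fun s => '<| g s, h s |>) ('<| dg, h t |> + '<| g t, dh |>).
Proof.
move=> dg1 dh1; apply/is_derive_diff_quotient.
have -> : diff_quotient (fun s => '<| g s, h s |>) t =
    fun s => '<| diff_quotient g t s, h s |> + '<| g t, diff_quotient h t s |>.
  apply/funext => s; rewrite /diff_quotient !innerE /GRing.scale/=; ring.
apply: cvgD; apply: cvg_inner.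
- exact/is_derive_diff_quotient.
- by apply: cvg_within_filter; exact: is_derive_continuous dh1.
- exact: cvg_cst.
- exact/is_derive_diff_quotient.
Qed.

Lemma is_derive_linear (A : {linear X -> Y}) (g : R -> X) (dg : X) (t : R) :
  continuous A -> is_derive t 1 g dg -> is_derive t 1 (fun s => A (g s)) (A dg).
Proof.
move=> cA /is_derive_diff_quotient dg1; apply/is_derive_diff_quotient.
have -> : diff_quotient (fun s => A (g s)) t = A \o diff_quotient g t.
  by apply/funext => s; rewrite /diff_quotient /= linearZ/= (linearB A).
by apply: (cvg_comp _ _ dg1); exact: cA.
Qed.

Lemma is_derive_gradient (f : X -> R) (gradf : X -> X) (g : R -> X) (dg : X) (t : R) :
  is_gradient f gradf -> is_derive t 1 g dg ->
  is_derive t 1 (fun s => f (g s)) '<| gradf (g t), dg |>.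
Proof.
move=> fg [dv <-].
have gd : differentiable g t by apply/derivable1_diffP.
have [fd fE] := fg (g t).
have cd : differentiable (f \o g) t by exact: differentiable_comp.
apply: DeriveDef; first exact/derivable1_diffP.
by rewrite deriveE// diff_comp//= fE deriveE.
Qed.

End HilbertDerivatives.

(** * Derivatives relative to a closed half-line *)

Section HalfLine.
Context {R : realType} {V : normedModType R}.
Implicit Types (g : R -> V) (t : R).

(** Points near an interior [t] lie in the half-line anyway, so the restricted and the ordinary
    punctured filters coincide. *)
Lemma derivable_in_interior (t0 t : R) g : t0 < t -> derivable_in `[t0, +oo[%classic g t ->
  is_derive t 1 g (derive_in `[t0, +oo[%classic g t).
Proof.
move=> tt; rewrite /derivable_in /derive_in.
suff -> : within `[t0, +oo[%classic (t^') = t^'.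
  by move=> c; apply/is_derive_diff_quotient.
rewrite eqEsubset; split => A; last exact: cvg_within.
rewrite /within/= => H.
have P : \forall s \near nbhs t, t0 <= s by near=> s; apply/ltW; near: s; exact: lt_nbhsr.
have {}H : \forall s \near nbhs t, s != t -> `[t0, +oo[%classic s -> A s := H.
change (\forall s \near nbhs t, s != t -> A s).
near=> s => ne; apply: (near H s) => //.
by rewrite /= in_itv/= andbT; near: s.
Unshelve. all: by end_near. Qed.

(** One-sided differentiability at [t0] only gives continuity from the right. Precomposing with
    [max t0] makes every approach to [t0] stay in the half-line, which yields the global continuity
    needed for compactness and integration. *)
Lemma derivable_in_continuous_max (t0 : R) g :
  (forall t, t0 <= t -> derivable_in `[t0, +oo[%classic g t) ->
  continuous (g \o Num.max t0).
Proof.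
move=> dg s /=.
set t := Num.max t0 s; have tt : t0 <= t by rewrite le_max lexx.
have /cvg_ex[/= l lP] := dg _ tt.
have ct : g r @[r --> within `[t0, +oo[%classic (nbhs t)] --> g t.
  have H : g r @[r --> within `[t0, +oo[%classic t^'] --> g t.
    rewrite -[X in _ --> X]addr0 -[X in _ --> _ + X](scale0r l).
    (* This also holds at [r = t], where both factors in front of the quotient vanish. *)
    have E : g = fun r => g t + (r - t) *: diff_quotient g t r.
      apply/funext => r; rewrite /diff_quotient scalerA.
      have [->|rt] := eqVneq r t; first by rewrite subrr mul0r scale0r addr0.
      by rewrite mulfV ?subr_eq0// scale1r addrC subrK.
    rewrite {1}E; apply: cvgD; first exact: cvg_cst.
    apply: cvgZ => //; apply/subr_cvg0.
    by apply: cvg_within_filter; apply: cvg_within_filter; exact: cvg_id.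
  move=> A gA.
  have {}H : \forall r \near nbhs t, r != t -> `[t0, +oo[%classic r -> A (g r) := H _ gA.
  change (\forall r \near nbhs t, `[t0, +oo[%classic r -> A (g r)).
  near=> r => rt.
  have [->|rr] := eqVneq r t; first exact: nbhs_singleton gA.
  by apply: (near H r).
apply: (@cvg_comp _ _ _ (Num.max t0) g _ (within `[t0, +oo[%classic (nbhs t))) => //.
move=> A H.
have {}H : \forall r \near nbhs t, `[t0, +oo[%classic r -> A r := H.
have cm : Num.max t0 r @[r --> s] --> t.
  exact: (@continuous_max _ R (cst t0) id s (cvg_cst _) cvg_id).
have {}H : \forall r \near s, t0 <= Num.max t0 r -> A (Num.max t0 r).
  by have := cm _ H; rewrite nbhs_simpl/=; apply: filterS => r + rr;
    apply; rewrite /= in_itv/= andbT.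
change (\forall r \near s, A (Num.max t0 r)).
by near=> r; apply: (near H r) => //; rewrite le_max lexx.
Unshelve. all: by end_near. Qed.

End HalfLine.

(** * Monotonicity, the mean value inequality and integrability from dissipation *)

Section RealLineCalculus.
Context {R : realType}.

Lemma nonincreasing_is_derive (f df : R -> R) (T : R) :
  (forall t, T <= t -> is_derive t 1 f (df t)) ->
  (forall t, T <= t -> df t <= 0) ->
  forall s t, T <= s -> s <= t -> f t <= f s.
Proof.
move=> fd d0 s t Ts st.
apply: (@ler0_derive1_nincry _ f T) => //.
- by move=> r; rewrite in_itv/= andbT => /ltW /fd[].
- by move=> r; rewrite in_itv/= andbT => /ltW Tr;
    rewrite derive1E (@derive_val _ _ _ _ _ _ _ (fd _ Tr)) d0.
- apply: derivable_within_continuous => r; rewrite in_itv/= andbT => /fd[]//.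
Qed.

(** Testing [g] against its own increment [y] reduces the claim to a scalar one: by Cauchy-Schwarz
    [<g s, y> - |y| p s] is nonincreasing, and dividing by [|y|] concludes. *)
Lemma norm_increment_le {X : hilbertType R} (g dg : R -> X) (p dp : R -> R) (T : R) :
  (forall t, T <= t -> is_derive t 1 g (dg t)) ->
  (forall t, T <= t -> is_derive t 1 p (dp t)) ->
  (forall t, T <= t -> `|dg t| <= dp t) ->
  forall t, T <= t -> `|g t - g T| <= p t - p T.
Proof.
move=> gd pd gp t Tt; set y := g t - g T.
have H : '<| g t, y |> - `|y| * p t <= '<| g T, y |> - `|y| * p T.
  apply: (@nonincreasing_is_derive (fun s => '<| g s, y |> - `|y| * p s)
    (fun s => '<| dg s, y |> - `|y| * dp s) T) => //.
  - move=> s Ts; apply: is_deriveB; last first.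
      by have := pd _ Ts => ?; exact: (@is_deriveZ _ _ _ p `|y|).
    have := is_derive_inner g (cst y) (dg s) 0 s (gd _ Ts) (is_derive_cst _ _ _).
    by rewrite inner0r addr0.
  - move=> s Ts; rewrite subr_le0 (le_trans (ler_norm _))//.
    by rewrite (le_trans (CauchySchwarz _ _))// mulrC ler_wpM2l// gp.
have {}H : `|y| * `|y| <= `|y| * (p t - p T).
  have : `|y| ^+ 2 = '<| g t, y |> - '<| g T, y |> by rewrite normE_inner -innerNl -innerDl.
  by rewrite -expr2 => ->; lra.
(* Division is impossible when [y = 0]; there it suffices that [p] is nondecreasing, because [dp]
   dominates a norm. *)
have [->|y0] := eqVneq `|y| 0.
  rewrite subr_ge0 -lerN2; apply: (@nonincreasing_is_derive (-%R \o p) (-%R \o dp) T) => //.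
  - by move=> s Ts; apply: is_deriveN; exact: pd.
  - by move=> s Ts /=; rewrite oppr_le0 (le_trans _ (gp _ Ts)).
by rewrite -(ler_pM2l (_ : 0 < `|y|))// lt_neqAle eq_sym y0 normr_ge0.
Qed.

(** With [F] a primitive of [g], the sum [E + F] is nonincreasing after [T]. As [E] stays
    nonnegative, [F] is bounded; being monotone it converges, and its limit gives the value of the
    improper integral. *)
Lemma integrable_dissipated (g E dE : R -> R) (t0 T : R) :
  t0 <= T -> continuous (g \o Num.max t0) ->
  (forall t, t0 <= t -> 0 <= g t) ->
  (forall t, T <= t -> is_derive t 1 E (dE t)) ->
  (forall t, T <= t -> dE t <= - g t) ->
  (forall t, T <= t -> 0 <= E t) ->
  lebesgue_measure.-integrable `[t0, +oo[ (EFin \o g).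
Proof.
move=> t0T cg g0 Ed dEg E0; set h := g \o Num.max t0 in cg.
have h0 t : 0 <= h t by apply: g0; rewrite le_max lexx.
have hg t : t0 <= t -> h t = g t by move=> tt; rewrite /h /= max_r.
(* Starting the primitive at [t0 - 1] makes [t0] an interior point, so that [F] is differentiable
   there too. *)
pose F x := \int[lebesgue_measure]_(t in `[t0 - 1, x]) h t.
have Fd x : t0 - 1 < x -> is_derive x 1 F (h x).
  move=> x0; have [] // := @continuous_FTC1_closed R h (t0 - 1) x (x + 1).
  - by rewrite ltrDl.
  - apply: continuous_compact_integrable; first exact: segment_compact.
    by apply: continuous_subspaceT => ?; exact: cg.
  - exact: cg.
  - by move=> ? ?; apply: DeriveDef; rewrite -?derive1E.
have t01 : t0 - 1 < t0 by rewrite gtrBl.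
have Fm s t : t0 <= s -> s <= t -> F s <= F t.
  move=> ts st; rewrite -lerN2.
  apply: (@nonincreasing_is_derive (-%R \o F) (-%R \o h) t0) => //.
  - by move=> r tr; apply: is_deriveN; apply: Fd; rewrite (lt_le_trans t01).
  - by move=> r tr /=; rewrite oppr_le0.
have EF t : T <= t -> E t + F t <= E T + F T.
  move=> Tt; apply: (@nonincreasing_is_derive (E \+ F) (dE \+ h) T) => //.
  - move=> r Tr; apply: is_deriveD; first exact: Ed.
    by apply: Fd; rewrite (lt_le_trans t01)// (le_trans t0T).
  - by move=> r Tr /=; rewrite hg ?(le_trans t0T)//; have := dEg _ Tr; lra.
(* Composition with [max t0] makes [F] monotone on the whole line, so its limit is the supremum of
   its range. *)
pose l := sup (range (F \o Num.max t0)).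
have Fl : F x @[x --> +oo] --> l.
  apply: (@cvg_trans _ ((F \o Num.max t0) x @[x --> +oo])).
    apply: near_eq_cvg; near=> x; rewrite /= max_r//.
  apply: nondecreasing_cvgr.
    move=> s t st /=; apply: Fm; first by rewrite le_max lexx.
    by rewrite ge_max le_max lexx/= le_max st orbT.
  exists (E T + F T) => _ [t _ <-] /=.
  set s := Num.max T t.
  apply: (@le_trans _ _ (F s)).
    apply: Fm; first by rewrite le_max lexx.
    by rewrite ge_max !le_max t0T lexx orbT.
  have Ts : T <= s by rewrite le_max lexx.
  by have := EF _ Ts; have := E0 _ Ts; lra.
have mh : measurable_fun `[t0, +oo[ h.
  apply: measurable_funTS; exact: continuous_measurable_fun.
apply: (@eq_integrable _ _ _ lebesgue_measure `[t0, +oo[%classic _ (EFin \o h)) => //.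
  by move=> x; rewrite inE/= in_itv/= andbT => /hg ->.
apply/integrableP; split; first exact/measurable_EFinP.
under eq_integral => x _ do rewrite /= ger0_norm//.
rewrite (@ge0_continuous_FTC2y _ h F t0 l) ?ltry//.
- by apply: continuous_subspaceT => ?; exact: cg.
- by move=> x tx; case: (Fd _ (lt_trans t01 tx)).
- by apply: cvg_within_filter; apply: (is_derive_continuous _ _ _ (Fd _ t01)).
- move=> x; rewrite in_itv/= andbT => tx; rewrite derive1E.
  exact: (@derive_val _ _ _ _ _ _ _ (Fd _ (lt_trans t01 tx))).
Unshelve. all: by end_near. Qed.
End RealLineCalculus.

(** By convexity the quotients of [f] along the segment from [x] to [y] are at most [f y - f x] for
    [0 < s <= 1]; the inequality passes to the limit [s -> 0+]. *)
Lemma gradient_inequality {R : realType} {X : hilbertType R}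
    (f : X -> R) (gradf : X -> X) (x y : X) :
  convex_function setT f -> is_gradient f gradf ->
  f x + '<| gradf x, y - x |> <= f y.
Proof.
move=> cf gf; pose g s := x + s *: (y - x).
have g1 : is_derive (0:R) 1 g (y - x).
  have := is_deriveD (is_derive_cst x (0:R) 1)
    (is_derive_scale id (cst (y - x)) 1 0 (0:R) (is_derive_id _ _) (is_derive_cst _ _ _)).
  by rewrite scaler0 addr0 scale1r add0r.
have g0 : g 0 = x by rewrite /g scale0r addr0.
have := is_derive_gradient f gradf g (y - x) 0 gf g1.
rewrite g0 => /is_derive_diff_quotient fg.
rewrite -lerBrDl; apply: (ler_cvg_to (cvg_dnbhs_at_right fg) (cvg_cst (f y - f x))).
near=> s; rewrite /diff_quotient subr0 g0 /g.
have s0 : 0 < s by near: s; exact: nbhs_right_gt.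
have s1 : s <= 1 by near: s; exact: nbhs_right_le.
have -> : x + s *: (y - x) = s *: y + (1 - s) *: x.
  by rewrite scalerBl scale1r scalerBr addrCA addrA.
have H : f (s *: y + (1 - s) *: x) <= s * f y + (1 - s) * f x.
  exact: (cf (Itv01 (ltW s0) s1) y x (mem_set I) (mem_set I)).
rewrite -(ler_pM2l s0) /GRing.scale/= mulrA mulfV ?gt_eqF// mul1r.
rewrite (le_trans (lerB H (lexx _)))//; lra.
Unshelve. all: by end_near. Qed.

(** * Algebra behind the derivative of the energy *)

Section EnergyAlgebra.
Context {R : realType} {X Y : hilbertType R}.
Variables (A : {linear X -> Y}) (AT : Y -> X).
Hypothesis A_adj : is_adjoint A AT.

Lemma energy_identity (k t c eta B : R) (p q dp dq G H : X) (r dr w u du : Y) :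
  p + (k * t) *: dp = q + (k * t) *: dq - eta *: dp + (k * t * c * B) *: G ->
  G = H + AT w -> w = r + (k * t) *: dr -> A q = u -> A dq = du ->
  '<| (k - 1 / 2) *: dp - (k * t * c) *: G, p + (k * t) *: dp |>
  + '<| (k - 1 / 2) *: dr + (k * t * c) *: (u + (k * t) *: du), w |>
  + (1 / 2 - k) * ('<| dp, p |> + '<| dr, r |>) =
  - ((1 / 2 - k) * k * t) * (`|dp| ^+ 2 + `|dr| ^+ 2)
  - k * t * c * '<| q, H |> - k ^+ 2 * t ^+ 2 * c * '<| dq, H |>
  + k * t * c * eta * '<| dp, G |> - k ^+ 2 * t ^+ 2 * c ^+ 2 * B * `|G| ^+ 2.
Proof.
move=> v_eq GE wE uE duE.
have Gq : '<| q, G |> = '<| q, H |> + '<| u, w |> by rewrite GE innerDr -A_adj uE.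
have Gdq : '<| dq, G |> = '<| dq, H |> + '<| du, w |> by rewrite GE innerDr -A_adj duE.
have vG : '<| G, p + (k * t) *: dp |> =
   '<| q, H |> + '<| u, w |> + k * t * ('<| dq, H |> + '<| du, w |>)
   - eta * '<| dp, G |> + k * t * c * B * `|G| ^+ 2.
  by rewrite v_eq innerC !innerE Gq Gdq normE_inner.
rewrite innerDl [X in X + _ + _]addrC innerNl [in X in - X]innerZl vG.
rewrite [X in _ + X + _]innerDl !innerZl [in '<| dr, w |>]wE !innerE.
rewrite !normE_inner (innerC dp p).
ring.
Qed.

(** Young's inequality: with [a = |dp|] and [q = k t c |G|], the square [B (q - a / 2)^2] bounds
    [B a q] by [B q^2 + B a^2 / 4], and [B q^2] is exactly the subtracted term. *)
Lemma cross_term_bound (k t c eta B M : R) (dp G : X) :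
  0 <= k * t * c -> `|eta| <= B -> B <= M ->
  k * t * c * eta * '<| dp, G |> - k ^+ 2 * t ^+ 2 * c ^+ 2 * B * `|G| ^+ 2
   <= M / 4 * `|dp| ^+ 2.
Proof.
move=> c0 eB BM; set q := k * t * c * `|G|; set a := `|dp|.
have B0 : 0 <= B by rewrite (le_trans _ eB).
have q0 : 0 <= q by rewrite mulr_ge0.
have H1 : k * t * c * eta * '<| dp, G |> <= B * a * q.
  rewrite (_ : B * a * q = k * t * c * (B * (a * `|G|))); last by rewrite /q; ring.
  rewrite -mulrA ler_wpM2l// (le_trans (ler_norm _))// normrM.
  by apply: ler_pM => //; exact: CauchySchwarz.
have H2 : B * a * q <= B * q ^+ 2 + B / 4 * a ^+ 2.
  have : 0 <= B * (q - a / 2) ^+ 2 by rewrite mulr_ge0 ?sqr_ge0.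
  by lra.
have H3 : B / 4 * a ^+ 2 <= M / 4 * a ^+ 2 by rewrite ler_wpM2r ?sqr_ge0//; lra.
have -> : k ^+ 2 * t ^+ 2 * c ^+ 2 * B * `|G| ^+ 2 = B * q ^+ 2 by rewrite /q; ring.
by lra.
Qed.

End EnergyAlgebra.

(** * The coefficients of the system for large times *)

Section Coefficients.
Context {R : realType}.
Implicit Types (alpha gamma beta t : R).

Lemma is_derive_damp gamma beta t : t != 0 ->
  is_derive t 1 (damp gamma beta) (- (beta / t ^+ 2)).
Proof.
move=> t0.
have /derivableP dV : derivable (fun s : R => s^-1) t 1 by apply: derivableV.
have := is_deriveD (is_derive_cst gamma t (1 : R)) (is_deriveZ beta dV).
rewrite deriveV// derive_id add0r -[damp gamma beta]/(cst gamma + beta \*: (fun s => s^-1)).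
by congr (is_derive _ _ _ _); rewrite /GRing.scale/= mulr1 mulrN.
Qed.

Lemma eta_coefE alpha gamma beta t : alpha != 0 -> t != 0 ->
  eta_coef alpha gamma beta t =
  - (damp gamma beta t / 2) - 3 / (2 * alpha) * beta / t.
Proof.
move=> a0 t0; rewrite /eta_coef derive1E.
rewrite (@derive_val _ _ _ _ _ _ _ (is_derive_damp gamma beta t t0)).
by rewrite /damp; field; rewrite a0 t0.
Qed.

(** Here [eta = - damp / 2 - k beta / t] with [k < 1/2], which is where [alpha > 3] enters. Either
    [beta / t] becomes small compared with [gamma > 0], or [damp] equals [beta / t >= 0] and
    [|eta| = (1/2 + k) damp]. *)
Lemma eta_le_damp alpha gamma beta :
  3 < alpha -> 0 < gamma \/ (gamma = 0 /\ 0 <= beta) ->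
  exists M T, forall t, T <= t ->
    `|eta_coef alpha gamma beta t| <= damp gamma beta t <= M.
Proof.
move=> a3 bc; have a0 : 0 < alpha by lra.
set k := 3 / (2 * alpha); have k0 : 0 < k by rewrite divr_gt0 ?mulr_gt0.
have k1 : k < 1 / 2 by rewrite /k ltr_pdivrMr ?mulr_gt0//; lra.
case: bc => [g0|[-> b0]].
(* Past this threshold [|beta / t| <= gamma / 2], so [damp] lies between [gamma / 2] and
   [3 gamma / 2]; the added 1 keeps [t] positive when [beta = 0]. *)
- exists (2 * gamma), (2 * `|beta| / gamma + 1) => t tT.
  have t1 : 0 < t.
    by rewrite (lt_le_trans _ tT)// ltr_wpDl// divr_ge0 ?mulr_ge0// ltW.
  have : `|beta / t| <= gamma / 2.
    rewrite normrM normfV (gtr0_norm t1) ler_pdivrMr//.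
    have : 2 * `|beta| / gamma * gamma <= t * gamma by rewrite ler_pM2r//; lra.
    rewrite mulfVK ?gt_eqF//; lra.
  rewrite eta_coefE ?gt_eqF// -/k /damp -mulrA; set z := beta / t.
  rewrite !ler_norml => /andP[z1 z2].
  have : `|k * z| <= k * (gamma / 2).
    by rewrite normrM gtr0_norm// ler_pM2l// ler_norml z1.
  rewrite ler_norml => /andP[z3 z4].
  have : k * gamma < 1 / 2 * gamma by rewrite ltr_pM2r.
  lra.
- exists beta, 1 => t t1; have tt : 0 < t by lra.
  rewrite eta_coefE ?gt_eqF// -/k /damp add0r -[k * beta / t]mulrA; set z := beta / t.
  have z0 : 0 <= z by rewrite divr_ge0// ltW.
  have : k * z <= 1 / 2 * z by rewrite ler_wpM2r// ltW.
  have kz : 0 <= k * z by rewrite mulr_ge0// ltW.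
  have : z <= beta by rewrite ler_pdivrMr// ler_peMr.
  rewrite ler_norml; lra.
Qed.

End Coefficients.

(** * Saddle points and the augmented Lagrangian gap *)

Section SaddlePoints.
Context {R : realType} {X Y : hilbertType R}.
Variables (f : X -> R) (gradf : X -> X).
Variables (A : {linear X -> Y}) (AT : Y -> X) (b : Y) (rho : R).
Variables (xs : X) (ls : Y).
Hypothesis f_convex : convex_function setT f.
Hypothesis f_grad : is_gradient f gradf.
Hypothesis A_cont : continuous A.
Hypothesis A_adj : is_adjoint A AT.
Hypothesis opt : saddle_points f A b (xs, ls).

Definition gap z := augLagr f A b rho z ls - augLagr f A b rho xs ls.

(** Moving the multiplier from [ls] by the residual [A xs - b] raises the Lagrangian by the squared
    residual, which maximality in the multiplier forbids unless it is 0. *)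
Lemma saddle_feasible : A xs = b.
Proof.
have [] := opt xs (ls + (A xs - b)); rewrite /Lagr /= => H _.
have : `|A xs - b| ^+ 2 <= 0 by rewrite normE_inner; move: H; rewrite innerDl; lra.
by rewrite exprn_even_le0//= normr_eq0 subr_eq0 => /eqP.
Qed.

Lemma gapE z : gap z = f z - f xs + '<| ls, A z - b |> + rho / 2 * `|A z - b| ^+ 2.
Proof.
rewrite /gap /augLagr /Lagr saddle_feasible subrr normr0 expr0n/= mulr0.
by rewrite inner0r; lra.
Qed.

Lemma gap_ge z : rho / 2 * `|A z - b| ^+ 2 <= gap z.
Proof.
have [_] := opt z ls; rewrite /gap /augLagr /Lagr/= saddle_feasible subrr normr0; lra.
Qed.

(** The gradient of the penalty, paired with [z - xs], gives [rho |A z - b|^2], twice the penalty in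
    the gap. The surplus half is what later makes the squared residual integrable. *)
Lemma gap_convex z :
  gap z + rho / 2 * `|A z - b| ^+ 2 <=
  '<| z - xs, grad_x_augLagr gradf A AT b rho z ls |>.
Proof.
have Az : A (z - xs) = A z - b by rewrite linearB saddle_feasible.
have := gradient_inequality f gradf z xs f_convex f_grad.
rewrite -(opprB z xs) innerNr (innerC (gradf z)) /grad_x_augLagr !innerDr innerZr -!A_adj Az.
by rewrite -normE_inner gapE (innerC ls); lra.
Qed.

Lemma is_derive_gap (g : R -> X) (dg : X) (t : R) : is_derive t 1 g dg ->
  is_derive t 1 (fun s => gap (g s))
    '<| dg, grad_x_augLagr gradf A AT b rho (g t) ls |>.
Proof.
move=> g1; have GE : '<| dg, grad_x_augLagr gradf A AT b rho (g t) ls |> =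
    '<| dg, gradf (g t) |> + '<| A dg, ls |> + rho * '<| A dg, A (g t) - b |>.
  by rewrite /grad_x_augLagr !innerDr innerZr -!A_adj innerDr.
have df := is_derive_gradient f gradf g dg t f_grad g1.
have dA : is_derive t 1 (fun s => A (g s) - b) (A dg).
  rewrite -[A dg]subr0; apply: is_deriveB; exact: is_derive_linear.
have dl := is_derive_inner (cst ls) _ 0 _ t (is_derive_cst _ _ _) dA.
have dq := is_deriveZ (rho / 2) (is_derive_inner _ _ _ _ t dA dA).
have := is_deriveD (is_deriveD (is_deriveD df (is_derive_cst (- f xs) t (1:R))) dl) dq.
have -> : (fun s => gap (g s)) =
  (fun s => f (g s)) + cst (- f xs) + (fun s => '<| cst ls s, A (g s) - b |>) +
  (rho / 2) \*: (fun s => '<| A (g s) - b, A (g s) - b |>).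
  by apply/funext => s; rewrite gapE normE_inner.
congr (is_derive _ _ _ _).
rewrite GE inner0l /GRing.scale/=.
by rewrite (innerC (gradf _)) (innerC ls) (innerC (A (g t) - b)); lra.
Qed.

End SaddlePoints.

(** * Derivatives of the terms of the energy, and the weighted residual bound *)

(** Since [kappa alpha = 3/2], the velocity coefficient [1 + kappa - kappa alpha] is
    [kappa - 1/2]. *)
Lemma is_derive_anchored {R : realType} {X : hilbertType R}
    (y dy : R -> X) (ddy z ys : X) (alpha t : R) :
  alpha != 0 -> t != 0 ->
  is_derive t 1 y (dy t) -> is_derive t 1 dy ddy ->
  ddy = - ((alpha / t) *: dy t) + z ->
  is_derive t 1 (fun s => y s - ys + (3 / (2 * alpha) * s) *: dy s)
    ((3 / (2 * alpha) - 1 / 2) *: dy t + (3 / (2 * alpha) * t) *: z).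
Proof.
move=> a0 t0 y1 y2 eqy.
have k1 := is_deriveZ (3 / (2 * alpha)) (is_derive_id t (1:R)).
have := is_deriveD (is_deriveD y1 (is_derive_cst (- ys) t (1:R)))
  (is_derive_scale _ _ _ _ _ k1 y2).
congr (is_derive _ _ _ _); apply: inner_ext => h.
rewrite eqy !innerE inner0l [_%:A]mulr1.
rewrite -[(_ \*: id) t]/(3 / (2 * alpha) * t).
by field; rewrite a0 t0.
Qed.

Lemma is_derive_half_sqnorm {R : realType} {X : hilbertType R}
    (g : R -> X) (dg : X) (t : R) :
  is_derive t 1 g dg -> is_derive t 1 (fun s => `|g s| ^+ 2 / 2) '<| dg, g t |>.
Proof.
move=> g1; have := is_deriveZ (2^-1) (is_derive_inner g g dg dg t g1 g1).
have -> : (2^-1) \*: (fun s => '<| g s, g s |>) = fun s => `|g s| ^+ 2 / 2.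
  by apply/funext => s; rewrite normE_inner mulrC.
by congr (is_derive _ _ _ _); rewrite /GRing.scale/= (innerC (g t)); field.
Qed.

Lemma is_derive_sqr {R : realType} (t : R) : is_derive t 1 (fun s : R => s ^+ 2) (2 * t).
Proof.
have := is_derive_scale id id 1 1 t (is_derive_id t (1:R)) (is_derive_id t (1:R)).
have -> : (fun s : R => id s *: id s) = fun s => s ^+ 2 by apply/funext => s; rewrite expr2.
by congr (is_derive _ _ _ _); rewrite /GRing.scale/=; ring.
Qed.

Lemma is_derive_inv {R : realType} (m : R -> R) (dm t : R) : m t != 0 ->
  is_derive t 1 m dm -> is_derive t 1 (fun s => (m s)^-1) (- (dm / m t ^+ 2)).
Proof.
move=> m0 [dv <-]; apply: DeriveDef; first exact: derivableV.
by rewrite deriveV// /GRing.scale/= mulNr mulrC.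
Qed.

Lemma powRB1 {R : realType} (a t : R) : 0 < t -> t `^ (a - 1) = t `^ a / t.
Proof.
move=> t0; rewrite powRD; last by rewrite (gt_eqF t0)/= implybT.
by rewrite powR_inv1// ltW.
Qed.

(* For P = t^(1/k) u and the nondecreasing weight n = t^(1/k) / (k^2 m) one has
   P' = n K', so P - n K has derivative - n' K. *)
Lemma weighted_residual_bound {R : realType} {Y : hilbertType R}
    (k C T : R) (m dm : R -> R) (u du K : R -> Y) :
  0 < k -> 0 < T ->
  (forall t, T <= t -> 0 < m t) ->
  (forall t, T <= t -> is_derive t 1 m (dm t)) ->
  (forall t, T <= t -> k * t * dm t <= m t) ->
  (forall t, T <= t -> is_derive t 1 u (du t)) ->
  (forall t, T <= t ->
    is_derive t 1 K ((k * m t / t) *: (u t + (k * t) *: du t))) ->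
  (forall t, T <= t -> `|K t| <= C) ->
  exists C', forall t, T <= t -> m t * `|u t| <= C'.
Proof.
move=> k0 T0 m0 md mk ud Kd KC; set a := k^-1.
have pos t : T <= t -> 0 < t by exact: lt_le_trans.
pose n t := t `^ a * (k ^+ 2 * m t)^-1.
(* The derivative of [n], factored so that its sign is that of [m - k t dm]. *)
pose dn t := t `^ a / t / k ^+ 3 / m t ^+ 2 * (m t - k * t * dm t).
have n0 t : T <= t -> 0 < n t.
  by move=> Tt; rewrite mulr_gt0 ?invr_gt0 ?mulr_gt0 ?exprn_gt0 ?m0// powR_gt0// pos.
have dn0 t : T <= t -> 0 <= dn t.
  move=> Tt; have tk := ltW (pos t Tt); have mt := ltW (m0 t Tt).
  rewrite mulr_ge0 ?subr_ge0 ?mk//.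
  by rewrite !divr_ge0 ?powR_ge0 ?exprn_ge0// ltW.
have pd t : T <= t -> is_derive t 1 (fun s : R => s `^ a) (a * (t `^ a / t)).
  by move=> Tt; rewrite -powRB1 ?pos//; exact/is_derive1_powR/pos.
have nd t : T <= t -> is_derive t 1 n (dn t).
  move=> Tt; have tn : t != 0 by rewrite gt_eqF ?pos.
  have mn : m t != 0 by rewrite gt_eqF ?m0.
  have kn : k != 0 by rewrite gt_eqF.
  have kmn : k ^+ 2 * m t != 0 by rewrite mulf_neq0 ?expf_neq0.
  have := is_derive_scale _ _ _ _ t (pd t Tt)
    (is_derive_inv (fun s => k ^+ 2 * m s) _ t kmn (is_deriveZ (k ^+ 2) (md t Tt))).
  congr (is_derive _ _ _ _); rewrite /GRing.scale/= /dn /a.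
  by field; rewrite tn mn kn.
pose P t := t `^ a *: u t - n t *: K t.
have Pd t : T <= t -> is_derive t 1 P (- (dn t *: K t)).
  move=> Tt; have tn : t != 0 by rewrite gt_eqF ?pos.
  have mn : m t != 0 by rewrite gt_eqF ?m0.
  have kn : k != 0 by rewrite gt_eqF.
  have := is_deriveB (is_derive_scale _ _ _ _ t (pd t Tt) (ud t Tt))
    (is_derive_scale _ _ _ _ t (nd t Tt) (Kd t Tt)).
  congr (is_derive _ _ _ _); apply: inner_ext => h; rewrite !innerE /n /a.
  by field; rewrite tn mn kn.
have C0 : 0 <= C by rewrite (le_trans _ (KC T (lexx T))).
have Cnd t : T <= t -> is_derive t 1 (fun s => C * n s) (C * dn t).
  by move=> Tt; exact: (is_deriveZ C (nd t Tt)).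
(* As [|P'| = dn |K| <= C dn], the function [C n] serves as the scalar majorant. *)
have PC t : T <= t -> `|P t - P T| <= C * n t - C * n T.
  apply: (norm_increment_le _ _ _ _ T Pd Cnd) => // s Ts.
  by rewrite normrN normrZ ger0_norm ?dn0// mulrC ler_wpM2r ?dn0// KC.
have nm t : T <= t -> n T <= n t.
  move=> Tt; rewrite -lerN2.
  apply: (nonincreasing_is_derive (fun s => - n s) (fun s => - dn s) T) => // s Ts.
    exact: is_deriveN (nd s Ts).
  by rewrite oppr_le0 dn0.
(* Since [k^2 m |u| = t^a |u| / n], this comes from dividing [|P T| + 2 C n t] by [n t] and using
   [n T <= n t]. *)
exists ((`|P T| / n T + 2 * C) / k ^+ 2) => t Tt.
have PT : t `^ a * `|u t| <= `|P T| + 2 * C * n t.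
  have -> : t `^ a * `|u t| = `|(P t - P T) + P T + n t *: K t|.
    by rewrite subrK /P subrK normrZ ger0_norm// powR_ge0.
  rewrite (le_trans (ler_normD _ _))// (le_trans (lerD (ler_normD _ _) (lexx _)))//.
  rewrite normrZ (gtr0_norm (n0 t Tt)).
  have h1 : n t * `|K t| <= n t * C by rewrite ler_wpM2l ?KC// ltW ?n0.
  have h2 : 0 <= C * n T by rewrite mulr_ge0// ltW ?n0.
  by have := PC t Tt; lra.
rewrite ler_pdivlMr ?exprn_gt0//.
have -> : m t * `|u t| * k ^+ 2 = t `^ a * `|u t| / n t.
  have tn : t `^ a != 0 by rewrite gt_eqF// powR_gt0// pos.
  have mn : m t != 0 by rewrite gt_eqF ?m0.
  have kn : k != 0 by rewrite gt_eqF.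
  by rewrite /n; field; rewrite tn mn kn.
rewrite ler_pdivrMr ?n0//; apply: (le_trans PT).
rewrite (mulrDl _ _ (n t)) lerD2r.
by rewrite mulrAC ler_pdivlMr ?n0// ler_wpM2l ?nm.
Qed.

(** * A fixed trajectory: the system in anchored variables *)

Section Trajectory.
Context {R : realType} {X Y : hilbertType R}.
Variables (f : X -> R) (gradf : X -> X).
Variables (A : {linear X -> Y}) (AT : Y -> X) (b : Y).
Variables (rho t0 alpha gamma beta t1 delta : R) (xi : R -> R).
Variables (x : R -> X) (lambda : R -> Y) (xs : X) (ls : Y).
Local Notation D := `[t0, +oo[%classic.
Hypothesis f_convex : convex_function setT f.
Hypothesis f_grad : is_gradient f gradf.
Hypothesis A_cont : continuous A.
Hypothesis A_adj : is_adjoint A AT.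
Hypothesis rho_gt0 : 0 < rho.
Hypothesis t0_gt0 : 0 < t0.
Hypothesis alpha_gt3 : 3 < alpha.
Hypothesis beta_cond : 0 < gamma \/ (gamma = 0 /\ 0 <= beta).
Hypothesis xi_gt0 : forall t, t0 <= t -> 0 < xi t.
Hypothesis xi_derivable : forall t, t0 <= t -> derivable_in D xi t.
Hypothesis t1_ge : t0 <= t1.
Hypothesis delta_gt0 : 0 < delta.
Hypothesis xi_cond : forall t, t1 <= t ->
  (2 - 2 * alpha / 3) + t * (derive_in D xi t / xi t) < - delta.
Hypothesis sol :
  is_PDDS_IHD_solution gradf A AT b rho t0 alpha gamma beta xi x lambda.
Hypothesis opt : saddle_points f A b (xs, ls).

Local Notation x' := (derive_in D x).
Local Notation x'' := (derive_in D x').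
Local Notation l' := (derive_in D lambda).
Local Notation l'' := (derive_in D l').
Local Notation xi' := (derive_in D xi).
Local Notation B := (damp gamma beta).
Local Notation kappa := (3 / (2 * alpha)).
Local Notation Gap := (gap f A b rho xs ls).

Let xhat t := x t + B t *: x' t.
Let xhat' t := x' t + (- (beta / t ^+ 2) *: x' t + B t *: x'' t).
Let res t := A (xhat t) - b.
Let v t := x t - xs + (kappa * t) *: x' t.
Let w t := lambda t - ls + (kappa * t) *: l' t.
Let G t := grad_x_augLagr gradf A AT b rho (xhat t) (lambda t + (kappa * t) *: l' t).

Let alpha_gt0 : 0 < alpha. Proof. exact: lt_trans alpha_gt3. Qed.
Let alpha_neq0 : alpha != 0. Proof. by rewrite gt_eqF. Qed.
Let kappa_gt0 : 0 < kappa. Proof. by rewrite divr_gt0 ?mulr_gt0. Qed.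
Let kappa_lt : kappa < 1 / 2.
Proof. by rewrite ltr_pdivrMr ?mulr_gt0//; move: alpha_gt3; lra. Qed.
Let pos t : t0 <= t -> 0 < t. Proof. exact: lt_le_trans. Qed.

Let in_D t : t0 <= t -> D t. Proof. by rewrite /= in_itv/= andbT. Qed.

Let x_derivable t : t0 <= t -> derivable_in D x t /\ derivable_in D x' t.
Proof. by case: sol => H1 _ _ /in_D /H1. Qed.

Let l_derivable t : t0 <= t -> derivable_in D lambda t /\ derivable_in D l' t.
Proof. by case: sol => _ H1 _ /in_D /H1. Qed.

Lemma is_derive_x t : t0 < t -> is_derive t 1 x (x' t).
Proof.
by move=> tt; apply: derivable_in_interior => //; case: (x_derivable t (ltW tt)).
Qed.

Lemma is_derive_x' t : t0 < t -> is_derive t 1 x' (x'' t).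
Proof.
by move=> tt; apply: derivable_in_interior => //; case: (x_derivable t (ltW tt)).
Qed.

Lemma is_derive_l t : t0 < t -> is_derive t 1 lambda (l' t).
Proof.
by move=> tt; apply: derivable_in_interior => //; case: (l_derivable t (ltW tt)).
Qed.

Lemma is_derive_l' t : t0 < t -> is_derive t 1 l' (l'' t).
Proof.
by move=> tt; apply: derivable_in_interior => //; case: (l_derivable t (ltW tt)).
Qed.

Lemma is_derive_xi t : t0 < t -> is_derive t 1 xi (xi' t).
Proof. by move=> tt; apply: derivable_in_interior => //; apply: xi_derivable; exact: ltW. Qed.

Lemma is_derive_xhat t : t0 < t -> is_derive t 1 xhat (xhat' t).
Proof.
move=> tt; apply: is_deriveD; first exact: is_derive_x.
apply: is_derive_scale; last exact: is_derive_x'.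
by apply: is_derive_damp; rewrite gt_eqF// pos// ltW.
Qed.

Lemma is_derive_res t : t0 < t -> is_derive t 1 res (A (xhat' t)).
Proof.
move=> tt; rewrite -[A _]subr0; apply: is_deriveB.
by apply: is_derive_linear => //; exact: is_derive_xhat.
Qed.

Lemma primal_equation t : t0 <= t -> x'' t = - ((alpha / t) *: x' t) + - (xi t *: G t).
Proof.
case: sol => _ _ eqs tt; have [e _] := eqs t tt.
by apply/eqP; rewrite -opprD -addr_eq0 addrA; apply/eqP.
Qed.

(** This identity explains the form of [eta] and of the gradient correction: once [x''] is
    eliminated from [xhat'], the terms in [G] cancel and [eta] is the excess coefficient of [x']. *)
Lemma anchored_primalE t : t0 <= t ->
  v t = xhat t - xs + (kappa * t) *: xhat' t - eta_coef alpha gamma beta t *: x' t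
        + (kappa * t * xi t * B t) *: G t.
Proof.
move=> tt; have t_neq0 : t != 0 by rewrite gt_eqF// pos.
rewrite /v /xhat' primal_equation// eta_coefE// /xhat.
apply: inner_ext => h; rewrite !innerE /damp.
by field; rewrite alpha_neq0 t_neq0.
Qed.

(** Applying [A] to [anchored_primalE] absorbs the [eta] and gradient terms, leaving the multiplier
    driven by the residual and its derivative alone. *)
Lemma dual_equation t : t0 <= t ->
  l'' t = - ((alpha / t) *: l' t) + xi t *: (res t + (kappa * t) *: A (xhat' t)).
Proof.
case: sol => _ _ eqs tt; have [_ e] := eqs t tt.
have -> : res t + (kappa * t) *: A (xhat' t) =
    A (x t + (kappa * t) *: x' t) - b + eta_coef alpha gamma beta t *: A (x' t)
    - (kappa * t * xi t * B t) *: A (G t).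
  have -> : x t + (kappa * t) *: x' t = xhat t + (kappa * t) *: xhat' t
     - eta_coef alpha gamma beta t *: x' t + (kappa * t * xi t * B t) *: G t.
    have := anchored_primalE t tt; rewrite /v => /(congr1 (fun z => z + xs)).
    set a := xhat t; set c := G t; move=> H; apply: inner_ext => h.
    by have := congr1 (fun z => '<| z, h |>) H; rewrite !innerE; lra.
  rewrite /res !linearD !linearN/= !linearZ/=; apply: inner_ext => h; rewrite !innerE; ring.
apply: inner_ext => h; have := congr1 (fun z => '<| z, h |>) e.
rewrite /grad_l_augLagr -/(xhat t) -/(G t) !innerE inner0l; lra.
Qed.

Lemma is_derive_v t : t0 < t ->
  is_derive t 1 v ((kappa - 1 / 2) *: x' t - (kappa * t * xi t) *: G t).
Proof.
move=> tt; have t_neq0 : t != 0 by rewrite gt_eqF// pos// ltW.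
have := is_derive_anchored x x' _ _ xs alpha t alpha_neq0 t_neq0
  (is_derive_x t tt) (is_derive_x' t tt) (primal_equation t (ltW tt)).
by rewrite scalerN scalerA.
Qed.

Lemma is_derive_w t : t0 < t ->
  is_derive t 1 w ((kappa - 1 / 2) *: l' t
    + (kappa * t * xi t) *: (res t + (kappa * t) *: A (xhat' t))).
Proof.
move=> tt; have t_neq0 : t != 0 by rewrite gt_eqF// pos// ltW.
have := is_derive_anchored lambda l' _ _ ls alpha t alpha_neq0 t_neq0
  (is_derive_l t tt) (is_derive_l' t tt) (dual_equation t (ltW tt)).
by rewrite scalerA.
Qed.

Let H t := grad_x_augLagr gradf A AT b rho (xhat t) ls.

(** The gradient is affine in the multiplier, and [w] is the offset of the extrapolated multiplier
    from [ls]. The part [H] is the gradient of the gap at [xhat]. *)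
Lemma gradientE t : G t = H t + AT (w t).
Proof.
have ATi y h : '<| AT y, h |> = '<| y, A h |> by rewrite innerC -A_adj innerC.
by apply: inner_ext => h; rewrite /G /H /grad_x_augLagr /w !innerE !ATi !innerE; ring.
Qed.

(** * The energy and its dissipation *)

Definition energy t :=
  `|v t| ^+ 2 / 2 + `|w t| ^+ 2 / 2
  + (1 / 2 - kappa) * (`|x t - xs| ^+ 2 / 2 + `|lambda t - ls| ^+ 2 / 2)
  + kappa ^+ 2 * (t ^+ 2 * xi t * Gap (xhat t)).

(** Left as the differentiation rules produce it, so that its first three summands match the left
    side of [energy_identity]. *)
Definition energy' t :=
  '<| (kappa - 1 / 2) *: x' t - (kappa * t * xi t) *: G t, v t |>
  + '<| (kappa - 1 / 2) *: l' t
        + (kappa * t * xi t) *: (res t + (kappa * t) *: A (xhat' t)), w t |>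
  + (1 / 2 - kappa) * ('<| x' t, x t - xs |> + '<| l' t, lambda t - ls |>)
  + kappa ^+ 2 * ((2 * t * xi t + t ^+ 2 * xi' t) * Gap (xhat t)
                  + t ^+ 2 * xi t * '<| xhat' t, H t |>).

Lemma is_derive_sqr_xi t : t0 < t ->
  is_derive t 1 (fun s => s ^+ 2 * xi s) (2 * t * xi t + t ^+ 2 * xi' t).
Proof.
move=> tt; exact: (is_derive_scale _ _ _ _ t (is_derive_sqr t) (is_derive_xi t tt)).
Qed.

Lemma is_derive_energy t : t0 < t -> is_derive t 1 energy (energy' t).
Proof.
move=> tt; apply: is_deriveD; first apply: is_deriveD; first apply: is_deriveD.
- by apply: is_derive_half_sqnorm; exact: is_derive_v.
- by apply: is_derive_half_sqnorm; exact: is_derive_w.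
- apply: (@is_deriveZ _ _ _ (fun s => _ + _)); apply: is_deriveD.
  + apply: is_derive_half_sqnorm; rewrite -[x' t]subr0; apply: is_deriveB.
    exact: is_derive_x.
  + apply: is_derive_half_sqnorm; rewrite -[l' t]subr0; apply: is_deriveB.
    exact: is_derive_l.
- apply: (@is_deriveZ _ _ _ (fun s => _)).
  apply: (is_derive_scale _ (fun s => Gap (xhat s))); first exact: is_derive_sqr_xi.
  by apply: is_derive_gap => //; exact: is_derive_xhat.
Qed.

Let Ax_feasible : A xs = b. Proof. exact: (saddle_feasible f A b xs ls). Qed.

Let Gap_ge t : rho / 2 * `|res t| ^+ 2 <= Gap (xhat t).
Proof. exact: gap_ge. Qed.

Let Gap_ge0 t : 0 <= Gap (xhat t).
Proof. by rewrite (le_trans _ (Gap_ge t))// mulr_ge0 ?sqr_ge0// divr_ge0// ltW. Qed.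

(** The velocity terms dissipate at rate [d t], half of which pays for the cross term. Convexity
    supplies [- kappa t xi] times the gap plus its surplus, and [xi_cond] keeps the growth of
    [t^2 xi] below that amount. *)
Lemma energy_dissipation : exists T c, [/\ t0 < T, t1 <= T, 0 < c & forall t, T <= t ->
  c * (t * (`|x' t| ^+ 2 + `|l' t| ^+ 2) + t * xi t * Gap (xhat t)
       + t * xi t * `|res t| ^+ 2) <= - energy' t].
Proof.
have [M [T0 MT]] := eta_le_damp alpha gamma beta alpha_gt3 beta_cond.
(* The packaged equation keeps [d] an opaque atom until [dE] is rewritten. *)
have [d dE] : {d | d = (1 / 2 - kappa) * kappa} by exists ((1 / 2 - kappa) * kappa).
have d0 : 0 < d by rewrite dE mulr_gt0 ?subr_gt0.
(* The three rates belong to the velocities, the gap and the squared residual, in this order. *)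
pose c := Num.min (d / 2) (Num.min (delta * kappa ^+ 2) (kappa * rho / 2)).
have c0 : 0 < c.
  rewrite !lt_min (divr_gt0 d0)//= (mulr_gt0 delta_gt0) ?exprn_gt0//=.
  by rewrite divr_gt0// mulr_gt0.
have [cd [c2 c3]] : c <= d / 2 /\ c <= delta * kappa ^+ 2 /\ c <= kappa * rho / 2.
  by split; [|split]; rewrite /c !ge_min lexx ?orbT.
clearbody c.
(* The bound [M / (2 d)] gives [M / 4 <= d t / 2], so the cross term costs at most half the velocity
   dissipation; [t1 + 1] makes the time exceed [t0] strictly. *)
exists (Num.max (t1 + 1) (Num.max T0 (M / (2 * d)))), c; split => //.
- by rewrite lt_max (le_lt_trans t1_ge)// ltrDl.
- by rewrite le_max lerDl ler01.
move=> t; rewrite !ge_max => /andP[tt1 /andP[/MT /andP[eB BM] tM]].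
have tt : t0 <= t by rewrite (le_trans t1_ge)// (le_trans _ tt1)// lerDl.
have t_gt0 := pos t tt; have xit := xi_gt0 t tt.
have Ek := energy_identity A AT A_adj kappa t (xi t) (eta_coef alpha gamma beta t)
  (B t) (x t - xs) (xhat t - xs) (x' t) (xhat' t) (G t) (H t) (lambda t - ls)
  (l' t) (w t) (res t) (A (xhat' t)) (anchored_primalE t tt) (gradientE t) erefl _ erefl.
have {}Ek := Ek (etrans (linearB A _ _) (congr1 (fun z => A (xhat t) - z) Ax_feasible)).
have kt0 : 0 <= kappa * t * xi t := ltW (mulr_gt0 (mulr_gt0 kappa_gt0 t_gt0) xit).
have txi0 : 0 <= t * xi t := ltW (mulr_gt0 t_gt0 xit).
have cross := cross_term_bound kappa t (xi t) (eta_coef alpha gamma beta t) (B t) M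
  (x' t) (G t) kt0 eB BM.
have cvx := gap_convex f gradf A AT b rho xs ls f_convex f_grad A_adj opt (xhat t).
have cvx2 : kappa * t * xi t * (Gap (xhat t) + rho / 2 * `|res t| ^+ 2)
   <= kappa * t * xi t * '<| xhat t - xs, H t |> by rewrite ler_wpM2l.
(* This is [xi_cond] multiplied by [kappa^2 t xi], using [2 alpha / 3 = 1 / kappa]. *)
have xiG : kappa ^+ 2 * (2 * t * xi t + t ^+ 2 * xi' t) * Gap (xhat t)
    <= (kappa * t * xi t - delta * kappa ^+ 2 * (t * xi t)) * Gap (xhat t).
  rewrite ler_wpM2r//.
  have := ltW (xi_cond t (le_trans _ tt1)); rewrite lerDl ler01 => /(_ isT) h.
  have : kappa ^+ 2 * (t * xi t) * (2 - 2 * alpha / 3 + t * (xi' t / xi t)) <=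
      kappa ^+ 2 * (t * xi t) * - delta.
    by rewrite ler_wpM2l// mulr_ge0// sqr_ge0.
  have -> : kappa ^+ 2 * (t * xi t) * (2 - 2 * alpha / 3 + t * (xi' t / xi t)) =
      kappa ^+ 2 * (2 * t * xi t + t ^+ 2 * xi' t) - kappa * t * xi t.
    by field; rewrite alpha_neq0 gt_eqF.
  by lra.
have Mt : M / 4 <= d / 2 * t.
  by move: tM; rewrite ler_pdivrMr ?mulr_gt0// => tM; lra.
have Mx : M / 4 * `|x' t| ^+ 2 <= d / 2 * t * `|x' t| ^+ 2 by rewrite ler_wpM2r ?sqr_ge0.
have a1 : c * (t * (`|x' t| ^+ 2 + `|l' t| ^+ 2)) <=
    d / 2 * (t * (`|x' t| ^+ 2 + `|l' t| ^+ 2)).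
  by rewrite ler_wpM2r// mulr_ge0 ?addr_ge0 ?sqr_ge0// (ltW t_gt0).
have a2 : c * (t * xi t * Gap (xhat t)) <= delta * kappa ^+ 2 * (t * xi t * Gap (xhat t)).
  by rewrite ler_wpM2r// (mulr_ge0 txi0).
have a3 : c * (t * xi t * `|res t| ^+ 2) <= kappa * rho / 2 * (t * xi t * `|res t| ^+ 2).
  by rewrite ler_wpM2r// (mulr_ge0 txi0)// sqr_ge0.
have a4 : 0 <= d / 2 * t * `|l' t| ^+ 2.
  by rewrite mulr_ge0 ?sqr_ge0// mulr_ge0 ?(ltW t_gt0)// divr_ge0// ltW.
rewrite /energy' Ek.
move: Ek cross cvx2 xiG Mx a1 a2 a3 a4; rewrite dE.
set n1 := `|x' t| ^+ 2; set n2 := `|l' t| ^+ 2; set n3 := `|res t| ^+ 2; set n4 := `|G t| ^+ 2.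
set i1 := '<| xhat' t, H t |>; set i2 := '<| xhat t - xs, H t |>; set i3 := '<| x' t, G t |>.
set g := Gap _; set k := kappa; move=> _.
lra.
Qed.

(** After [T] the energy is nonincreasing and its terms are nonnegative, so each stays bounded. The
    velocities follow from [kappa t x' = v - (x - xs)] and its dual analogue; the residual needs
    [weighted_residual_bound]. *)
Lemma trajectory_bounds : exists T C, t0 < T /\ forall t, T <= t ->
  [/\ `|x t - xs| <= C, `|lambda t - ls| <= C, t * `|x' t| <= C, t * `|l' t| <= C
    & t ^+ 2 * xi t * Gap (xhat t) <= C] /\ t ^+ 2 * xi t * `|res t| <= C.
Proof.
have [T [c [t0T t1T c0 diss]]] := energy_dissipation.
have T0 : 0 < T by rewrite (lt_trans t0_gt0).
have inT t : T <= t -> t0 < t by exact: lt_le_trans.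
pose d := 1 / 2 - kappa; have d0 : 0 < d by rewrite subr_gt0.
have decr t : T <= t -> energy t <= energy T.
  apply: (nonincreasing_is_derive energy energy' T) => // [s Ts|s Ts].
    exact/is_derive_energy/inT.
  rewrite -oppr_ge0 (le_trans _ (diss s Ts))//.
  have s0 := ltW (pos s (ltW (inT s Ts))); have xis := ltW (xi_gt0 s (ltW (inT s Ts))).
  by rewrite mulr_ge0 ?(ltW c0)// !addr_ge0// !mulr_ge0// ?addr_ge0// sqr_ge0.
have xi0 t : T <= t -> 0 <= t ^+ 2 * xi t.
  by move=> Tt; rewrite mulr_ge0 ?sqr_ge0// ltW// xi_gt0// ltW// inT.
(* The minimum is taken over the weights of the terms of the energy, and the 2 compensates the
   halved squares. *)
pose Q := 2 * energy T / Num.min 1 (Num.min d (kappa ^+ 2)).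
set mn := Num.min 1 _ in Q.
have mn0 : 0 < mn by rewrite !lt_min ltr01 d0 exprn_gt0.
have [mn1 [mnd mnk]] : mn <= 1 /\ mn <= d /\ mn <= kappa ^+ 2.
  by split; [|split]; rewrite /mn !ge_min lexx ?orbT.
have QP t : T <= t -> [/\ `|v t| ^+ 2 <= Q, `|w t| ^+ 2 <= Q, `|x t - xs| ^+ 2 <= Q,
   `|lambda t - ls| ^+ 2 <= Q & t ^+ 2 * xi t * Gap (xhat t) <= Q].
  move=> Tt; have := decr t Tt; rewrite {1}/energy -/d.
  have := mulr_ge0 (xi0 t Tt) (Gap_ge0 t).
  have := sqr_ge0 `|v t|; have := sqr_ge0 `|w t|.
  have := sqr_ge0 `|x t - xs|; have := sqr_ge0 `|lambda t - ls|.
  set q1 := `|v t| ^+ 2; set q2 := `|w t| ^+ 2; set q3 := `|x t - xs| ^+ 2.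
  set q4 := `|lambda t - ls| ^+ 2; set q5 := _ * Gap _ => p4 p3 p2 p1 p5 H1.
  have le (r z : R) : 0 <= z -> mn <= r -> mn * z <= r * z by move=> *; rewrite ler_wpM2r.
  have := le _ _ p1 mn1; have := le _ _ p2 mn1; have := le _ _ p3 mnd.
  have := le _ _ p4 mnd; have := le _ _ p5 mnk.
  have z3 := mulr_ge0 (ltW d0) p3; have z4 := mulr_ge0 (ltW d0) p4.
  have z5 := mulr_ge0 (sqr_ge0 kappa) p5.
  move=> m5 m4 m3 m2 m1; rewrite /Q !ler_pdivlMr//.
  by split; lra.
have Q0 : 0 <= Q by case: (QP T (lexx T)) => + _ _ _ _; apply: le_trans; exact: sqr_ge0.
pose S := Num.sqrt Q.
have sqrtS (Z : hilbertType R) (z : Z) : `|z| ^+ 2 <= Q -> `|z| <= S.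
  by move=> zQ; rewrite -(ger0_norm (normr_ge0 z)) -sqrtr_sqr ler_wsqrtr.
have S0 : 0 <= S by exact: sqrtr_ge0.
have by_anchor (Z : hilbertType R) (z dz : Z) (t : R) : 0 <= t ->
    `|z| <= S -> `|z + (kappa * t) *: dz| <= S -> t * `|dz| <= 2 * S / kappa.
  move=> t_ge0 zS zvS; rewrite ler_pdivlMr// [X in X <= _](_ : _ = `|(kappa * t) *: dz|).
    rewrite -[(kappa * t) *: dz](addKr z) (le_trans (ler_normD _ _))// normrN; lra.
  by rewrite normrZ (ger0_norm (mulr_ge0 (ltW kappa_gt0) t_ge0)); ring.
(* The role of [K] is played by [w + d (lambda - ls)]: as [d = 1/2 - kappa], the [lambda'] terms
   cancel in its derivative. *)
have [||||||C' HC'] := weighted_residual_bound kappa (S + d * S) T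
  (fun s => s ^+ 2 * xi s) (fun s => 2 * s * xi s + s ^+ 2 * xi' s) res
  (fun s => A (xhat' s)) (fun s => w s + d *: (lambda s - ls)) kappa_gt0 T0.
- by move=> t Tt; rewrite mulr_gt0 ?xi_gt0 ?exprn_gt0 ?(lt_le_trans T0)// ltW// inT.
- by move=> t Tt; exact/is_derive_sqr_xi/inT.
(* For [m = t^2 xi], the difference [kappa t m' - m] equals [kappa m] times the left side of
   [xi_cond], again by [2 alpha / 3 = 1 / kappa]. *)
- move=> t Tt; have tt := ltW (inT t Tt); have t_gt0 := pos t tt; have xit := xi_gt0 t tt.
  have H1 := ltW (xi_cond t (le_trans t1T Tt)).
  have H2 : kappa * (t ^+ 2 * xi t) * (2 - 2 * alpha / 3 + t * (xi' t / xi t)) <= 0.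
    rewrite mulr_ge0_le0 ?(mulr_ge0 (ltW kappa_gt0)) ?xi0// (le_trans H1)//.
    by rewrite oppr_le0 ltW.
  rewrite -subr_le0 (le_trans _ H2)// le_eqVlt; apply/orP; left; apply/eqP.
  by field; rewrite alpha_neq0 gt_eqF.
- by move=> t Tt; exact/is_derive_res/inT.
- move=> t Tt; have tt := inT t Tt; have t_neq0 : t != 0 by rewrite gt_eqF// pos// ltW.
  have dl : is_derive t 1 (fun s => d *: (lambda s - ls)) (d *: l' t).
    apply: (@is_deriveZ _ _ _ (fun s => _)); rewrite -[l' t]subr0.
    by apply: is_deriveB; exact: is_derive_l.
  have := is_deriveD (is_derive_w t tt) dl.
  congr (is_derive _ _ _ _); apply: inner_ext => h; rewrite !innerE /d.
  by field; rewrite t_neq0 alpha_neq0.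
- move=> t Tt; case: (QP t Tt) => _ /sqrtS wS _ /sqrtS lS _.
  rewrite (le_trans (ler_normD _ _))// lerD// normrZ gtr0_norm//.
  by rewrite ler_wpM2l// ltW.
pose C := Num.max (Num.max S (2 * S / kappa)) (Num.max Q C').
have [C1 [C2 [C3 C4]]] : S <= C /\ 2 * S / kappa <= C /\ Q <= C /\ C' <= C.
  by split; [|split; [|split]]; rewrite /C !le_max lexx ?orbT.
exists T, C; split=> // t Tt; case: (QP t Tt) => /sqrtS vS /sqrtS wS /sqrtS xS /sqrtS lS gS.
have t_ge0 := ltW (pos t (ltW (inT t Tt))).
split; last exact: le_trans (HC' t Tt) C4.
split; [exact: le_trans xS C1|exact: le_trans lS C1| | |exact: le_trans gS C3].
- by apply: le_trans C2; exact: (by_anchor _ (x t - xs)).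
- by apply: le_trans C2; exact: (by_anchor _ (lambda t - ls)).
Qed.

(* Composing with [e] freezes the trajectory before [t0], which turns continuity
   from the right at [t0] into continuity on the whole line. *)
Let e t := Num.max t0 t.
Let t0_le_e t : t0 <= e t. Proof. by rewrite le_max lexx. Qed.
Let e_id t : t0 <= t -> e t = t. Proof. by move=> tt; rewrite /e max_r. Qed.

Let e_cont : continuous e.
Proof. by move=> t; exact: (@continuous_max _ R (cst t0) id t (cvg_cst _) cvg_id). Qed.

Let x_cont : continuous (x \o e).
Proof. by apply: derivable_in_continuous_max => t /x_derivable[]. Qed.

Let x'_cont : continuous (x' \o e).
Proof. by apply: derivable_in_continuous_max => t /x_derivable[]. Qed.

Let l_cont : continuous (lambda \o e).
Proof. by apply: derivable_in_continuous_max => t /l_derivable[]. Qed.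

Let l'_cont : continuous (l' \o e).
Proof. by apply: derivable_in_continuous_max => t /l_derivable[]. Qed.

Let xi_cont : continuous (xi \o e).
Proof. exact: derivable_in_continuous_max. Qed.

Let xhat_cont : continuous (xhat \o e).
Proof.
move=> t; apply: cvgD; first exact: x_cont.
apply: cvgZ; last exact: x'_cont.
have et0 : e t != 0 by rewrite gt_eqF// pos.
apply: continuous_comp; first exact: e_cont.
exact: (is_derive_continuous _ _ _ (is_derive_damp gamma beta (e t) et0)).
Qed.

Let res_cont : continuous (res \o e).
Proof.
move=> t; apply: cvgB; last exact: cvg_cst.
exact: (cvg_comp _ _ (xhat_cont t) (A_cont _)).
Qed.

Let Gap_cont : continuous (fun t => Gap (xhat (e t))).
Proof.
under eq_fun => t do rewrite gapE//.
move=> t; apply: cvgD; first apply: cvgD.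
- apply: cvgB; last exact: cvg_cst.
  apply: (cvg_comp _ _ (xhat_cont t)).
  by apply: differentiable_continuous; case: (f_grad (xhat (e t))).
- by apply: cvg_inner; [exact: cvg_cst|exact: res_cont].
- apply: cvgM; first exact: cvg_cst.
  by under eq_fun do rewrite expr2; apply: cvgM; apply: cvg_norm; exact: res_cont.
Qed.

Let txi_cont : continuous (fun t => e t * xi (e t)).
Proof. by move=> t; apply: cvgM; [exact: e_cont|exact: xi_cont]. Qed.

Let sqr_norm_cont (Z : hilbertType R) (g : R -> Z) :
  continuous g -> continuous (fun t => `|g t| ^+ 2).
Proof.
by move=> gc t; under eq_fun do rewrite expr2; apply: cvgM; apply: cvg_norm; exact: gc.
Qed.

(** * Boundedness, integral estimates and rates *)

(** The energy controls the trajectory after [T]; on the compact interval from [t0] to [T] a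
    continuous function attains its maximum. *)
Lemma trajectory_bounded : [bounded prod_norm (x t) (lambda t) | t in D].
Proof.
have [T [C [t0T HC]]] := trajectory_bounds.
pose N t := `|x (e t)| + `|lambda (e t)|.
have cN : continuous N.
  by move=> t; apply: cvgD; apply: cvg_norm; [exact: x_cont|exact: l_cont].
have cNw : {within `[t0, T], continuous N} by apply: continuous_subspaceT.
have [c _ cmax] := @EVT_max R N t0 T (ltW t0T) cNw.
exists (Num.max (N c) (2 * C + `|xs| + `|ls|)); split; first exact: num_real.
move=> M /ltW MM t /=; rewrite in_itv/= andbT => tt; apply: le_trans MM.
rewrite (le_trans (prod_norm_le _ _))// le_max; have [Tt|tT] := leP T t.
  have [[xC lC _ _ _] _] := HC t Tt; apply/orP; right.
  have := ler_normD (x t - xs) xs; have := ler_normD (lambda t - ls) ls.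
  by rewrite !subrK; lra.
by have := cmax t; rewrite in_itv/= tt (ltW tT) /N e_id// => ->.
Qed.

(** Shared by the three integral estimates: [energy / c] is nonnegative and dissipates at least [g]
    from some time on. *)
Lemma trajectory_integrable (g : R -> R) :
  continuous (g \o e) -> (forall t, t0 <= t -> 0 <= g t) ->
  (forall t, t0 <= t -> g t <= t * (`|x' t| ^+ 2 + `|l' t| ^+ 2)
     + t * xi t * Gap (xhat t) + t * xi t * `|res t| ^+ 2) ->
  lebesgue_measure.-integrable D (fun t => (g t)%:E).
Proof.
move=> gc g0 gle; have [T [c [t0T t1T c0 diss]]] := energy_dissipation.
have inT t : T <= t -> t0 < t by exact: lt_le_trans.
apply: (integrable_dissipated g (fun s => c^-1 * energy s)
  (fun s => c^-1 * energy' s) t0 T) => //.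
- exact: ltW.
- move=> t Tt; apply: (@is_deriveZ _ _ _ energy c^-1); exact/is_derive_energy/inT.
- move=> t Tt; rewrite lerNr -mulrN mulrC ler_pdivlMr// mulrC.
  by rewrite (le_trans _ (diss t Tt))// ler_pM2l// gle// ltW// inT.
- move=> t Tt; have tt := ltW (inT t Tt).
  rewrite mulr_ge0 ?invr_ge0 ?(ltW c0)// /energy !addr_ge0 ?divr_ge0 ?sqr_ge0//.
    by rewrite mulr_ge0 ?subr_ge0 ?(ltW kappa_lt)// addr_ge0 ?divr_ge0 ?sqr_ge0.
  by rewrite mulr_ge0 ?sqr_ge0// mulr_ge0// mulr_ge0 ?sqr_ge0// ltW// xi_gt0.
Qed.

Let terms_ge0 t : t0 <= t -> [/\ 0 <= t * (`|x' t| ^+ 2 + `|l' t| ^+ 2),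
  0 <= t * xi t * Gap (xhat t) & 0 <= t * xi t * `|res t| ^+ 2].
Proof.
move=> tt; have t_ge0 := ltW (pos t tt); have xi_ge0 := ltW (xi_gt0 t tt).
have txi_ge0 := mulr_ge0 t_ge0 xi_ge0; split.
- by rewrite mulr_ge0// addr_ge0 ?sqr_ge0.
- exact: mulr_ge0 txi_ge0 (Gap_ge0 t).
- by rewrite (mulr_ge0 txi_ge0)// sqr_ge0.
Qed.

Lemma gap_integrable :
  lebesgue_measure.-integrable D (fun t => (t * xi t * Gap (xhat t))%:E).
Proof.
apply: trajectory_integrable => [|t /terms_ge0[]//|t /terms_ge0[]]; last by lra.
by move=> t; exact: (cvgM (txi_cont t) (Gap_cont t)).
Qed.

Lemma velocity_integrable :
  lebesgue_measure.-integrable D (fun t => (t * (`|x' t| ^+ 2 + `|l' t| ^+ 2))%:E).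
Proof.
apply: trajectory_integrable => [|t /terms_ge0[]//|t /terms_ge0[]]; last by lra.
move=> t; apply: cvgM; first exact: e_cont.
exact: (cvgD (sqr_norm_cont _ _ x'_cont t) (sqr_norm_cont _ _ l'_cont t)).
Qed.

Lemma residual_integrable :
  lebesgue_measure.-integrable D (fun t => (t * xi t * `|res t| ^+ 2)%:E).
Proof.
apply: trajectory_integrable => [|t /terms_ge0[]//|t /terms_ge0[]]; last by lra.
by move=> t; exact: (cvgM (txi_cont t) (sqr_norm_cont _ _ res_cont t)).
Qed.

Lemma trajectory_rates :
  [/\ (fun t => Gap (xhat t)) =O_ +oo (fun t => (t ^+ 2 * xi t)^-1),
      (fun t => prod_norm (x' t) (l' t)) =O_ +oo (fun t => t^-1),
      (fun t => `|res t|) =O_ +oo (fun t => (t ^+ 2 * xi t)^-1) &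
      (fun t => `|f (xhat t) - f xs|) =O_ +oo (fun t => (t ^+ 2 * xi t)^-1)].
Proof.
have [T [C [t0T HC]]] := trajectory_bounds.
have m0 t : T <= t -> 0 < t ^+ 2 * xi t.
  move=> Tt; have tt := le_trans (ltW t0T) Tt.
  by rewrite mulr_gt0 ?exprn_gt0 ?xi_gt0// pos.
have C0 : 0 <= C by case: (HC T (lexx T)) => -[+ _ _ _ _] _; exact: le_trans.
have bigO (h m : R -> R) (k : R) : 0 <= k ->
    (forall t, T <= t -> 0 < m t /\ m t * `|h t| <= k) -> h =O_ +oo (fun t => (m t)^-1).
  (* The constant must be positive, whereas [k] may be 0. *)
  move=> k0 mh; apply/eqO_exP; exists (k + 1); first by rewrite ltr_wpDl.
  near=> t; have Tt : T <= t by near: t; apply: nbhs_pinfty_ge; exact: num_real.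
  have [mt ht] := mh t Tt.
  rewrite normfV (gtr0_norm mt) ler_pdivlMr// mulrC (le_trans ht)// lerDl//.
split.
- apply: (bigO _ _ C) => // t Tt; split; first exact: m0.
  by case: (HC t Tt) => -[_ _ _ _ +] _; rewrite ger0_norm.
- apply: (bigO _ id (2 * C)) => [|t Tt]; first by rewrite mulr_ge0.
  have t_gt0 := pos t (le_trans (ltW t0T) Tt); split => //.
  case: (HC t Tt) => -[_ _ h1 h2 _] _.
  have : t * `|prod_norm (x' t) (l' t)| <= t * (`|x' t| + `|l' t|)
    by rewrite ler_pM2l// prod_norm_le.
  by rewrite /=; lra.
- apply: (bigO _ _ C) => // t Tt; split; first exact: m0.
  by case: (HC t Tt) => _; rewrite normr_id.
- apply: (bigO _ _ (2 * C + `|ls| * C)) => [|t Tt].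
    by rewrite addr_ge0 ?mulr_ge0.
  split; first exact: m0.
  case: (HC t Tt) => -[_ _ _ _ h1] h2; rewrite normr_id.
  (* By [gapE] the difference of values is the gap minus [<ls, res>] minus the penalty; the penalty
     is at most the gap, whence the factor 2. *)
  have fE : `|f (xhat t) - f xs| <= 2 * Gap (xhat t) + `|ls| * `|res t|.
    have := CauchySchwarz ls (res t); have := Gap_ge t; have := Gap_ge0 t.
    have := gapE f A b rho xs ls opt (xhat t); rewrite -/(res t).
    have : 0 <= rho / 2 * `|res t| ^+ 2 by rewrite mulr_ge0 ?sqr_ge0// divr_ge0// ltW.
    by rewrite !ler_norml => ? ? ? ? /andP[? ?]; lra.
  have : t ^+ 2 * xi t * `|f (xhat t) - f xs| <=
     t ^+ 2 * xi t * (2 * Gap (xhat t) + `|ls| * `|res t|) by rewrite ler_pM2l ?m0.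
  have : `|ls| * (t ^+ 2 * xi t * `|res t|) <= `|ls| * C by rewrite ler_wpM2l.
  by lra.
Unshelve. all: by end_near. Qed.

End Trajectory.

Theorem theorem1 (R : realType) (X Y : hilbertType R)
  (f : X -> R) (gradf : X -> X)
  (A : {linear X -> Y}) (AT : Y -> X) (b : Y)
  (rho t0 alpha gamma beta t1 delta : R) (xi : R -> R)
  (x : R -> X) (lambda : R -> Y) (xs : X) (ls : Y)
  (D := `[t0, +oo[%classic)
  (xhat := fun t => x t + damp gamma beta t *: derive_in D x t)
  (Lrho := augLagr f A b rho)
  (f_convex : convex_function setT f)
  (f_grad : is_gradient f gradf)
  (gradf_cont : continuous gradf)
  (A_cont : continuous A)
  (A_adj : is_adjoint A AT)
  (rho_gt0 : 0 < rho) (t0_gt0 : 0 < t0) (alpha_gt3 : 3 < alpha)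
  (beta_cond : 0 < gamma \/ (gamma = 0 /\ 0 <= beta))
  (xi_gt0 : forall t, t0 <= t -> 0 < xi t)
  (xi_derivable : forall t, t0 <= t -> derivable_in D xi t)
  (t1_ge : t0 <= t1) (delta_gt0 : 0 < delta)
  (xi_cond : forall t, t1 <= t ->
     (2 - 2 * alpha / 3) + t * (derive_in D xi t / xi t) < - delta)
  (sol : is_PDDS_IHD_solution gradf A AT b rho t0 alpha gamma beta xi x lambda)
  (opt : saddle_points f A b (xs, ls)) :
  [bounded prod_norm (x t) (lambda t) | t in D] /\
  [/\ lebesgue_measure.-integrable D
        (fun t => (t * xi t * (Lrho (xhat t) ls - Lrho xs ls))%:E),
      lebesgue_measure.-integrable D
        (fun t => (t * (`|derive_in D x t| ^+ 2
                        + `|derive_in D lambda t| ^+ 2))%:E) &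
      lebesgue_measure.-integrable D
        (fun t => (t * xi t * `|A (xhat t) - b| ^+ 2)%:E)] /\
  [/\ (fun t => Lrho (xhat t) ls - Lrho xs ls)
        =O_ +oo (fun t => (t ^+ 2 * xi t)^-1),
      (fun t => prod_norm (derive_in D x t) (derive_in D lambda t))
        =O_ +oo (fun t => t^-1),
      (fun t => `|A (xhat t) - b|)
        =O_ +oo (fun t => (t ^+ 2 * xi t)^-1) &
      (fun t => `|f (xhat t) - f xs|)
        =O_ +oo (fun t => (t ^+ 2 * xi t)^-1)].
Proof.
split.
  exact: (trajectory_bounded f gradf A AT b rho t0 alpha gamma beta t1 delta xi).
split; first split.
- exact: (gap_integrable f gradf A AT b rho t0 alpha gamma beta t1 delta xi x lambda).
- exact: (velocity_integrable f gradf A AT b rho t0 alpha gamma beta t1 delta xi x lambda).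
- exact: (residual_integrable f gradf A AT b rho t0 alpha gamma beta t1 delta xi x lambda).
exact: (trajectory_rates f gradf A AT b rho t0 alpha gamma beta t1 delta xi x lambda).
Qed.
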